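(* Let $p$ be a prime number. For any integer $n>1$, \[ |\mathcal{F}(\mathbb{Z}_{p^n}[\alpha])|=|\mathcal{F}(\mathbb{Z}_{p^n})|^2\cdot|St_\alpha(\mathbb{Z}_{p^n})|. \]
   Context: $\mathbb{Z}_m=\mathbb{Z}/m\mathbb{Z}$. For a commutative ring $R$ with $1$, the ring of dual numbers over $R$ is $R[\alpha]=R[x]/(x^2)$, where $\alpha=x+(x^2)$; so every element is uniquely $a+b\alpha$ with $a,b\in R$, $\alpha^2=0$, and $R$ is a subring of $R[\alpha]$ via $a\mapsto a+0\alpha$. For a finite commutative ring $A$, a polynomial function on $A$ is a function $A\to A$ of the form $a\mapsto f(a)$ for some $f\in A[x]$; $\mathcal{F}(A)$ is the set of polynomial functions on $A$, and $\mathcal{P}(A)$ is the group (under composition) of bijective polynomial functions on $A$. $St_\alpha(R)=\{F\in\mathcal{P}(R[\alpha])\mid F(a)=a\text{ for every }a\in R\}$. *)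

(* Defs.v *)
From HB Require Import structures.
From mathcomp Require Import all_boot all_fingroup all_order all_algebra.
From mathcomp Require Import boolp.

Set Implicit Arguments.
Unset Strict Implicit.
Unset Printing Implicit Defensive.

Import GRing.Theory.
Local Open Scope ring_scope.

(* R[alpha] = R[X]/(X^2). Since {poly %/ h} silently replaces h by 'X when h is
   not monic of size > 1, mk_monic_X2 checks that this does not happen here. *)
Definition dualnum (R : finComNzRingType) : predArgType :=
  {poly %/ ('X^2 : {poly R})}.

Section DualNumbers.
Variable R : finComNzRingType.

HB.instance Definition _ := Finite.copy (dualnum R) {poly %/ ('X^2 : {poly R})}.
HB.instance Definition _ :=
  GRing.ComNzRing.copy (dualnum R) {poly %/ ('X^2 : {poly R})}.

Lemma mk_monic_X2 : mk_monic 'X^2 = 'X^2 :> {poly R}.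
Proof. by rewrite /mk_monic size_polyXn monicXn. Qed.

Definition dual_inj (a : R) : dualnum R := qpolyC 'X^2 a.
HB.instance Definition _ :=
  GRing.RMorphism.copy dual_inj (qpolyC ('X^2 : {poly R})).

Definition dual_alpha : dualnum R := 'qX.

End DualNumbers.

Section PolynomialFunctions.
Variable A : finComNzRingType.

Definition is_polyfun (F : A -> A) : Prop :=
  exists f : {poly A}, forall a, F a = f.[a].

Definition polyfuns : {set {ffun A -> A}} := [set F : {ffun A -> A} | `[< is_polyfun F >]].

Definition polyperms : {set {perm A}} := [set s : {perm A} | `[< is_polyfun s >]].

Lemma polyperms_group_set : group_set polyperms.
Proof.
apply/group_setP; split=> [|s t].
  by rewrite inE; apply/asboolP; exists 'X => a; rewrite perm1 hornerX.
rewrite !inE => /asboolP[f sf] /asboolP[g tg]; apply/asboolP.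
by exists (g \Po f) => a; rewrite permM sf tg horner_comp.
Qed.

Canonical polyperms_group := Group polyperms_group_set.

End PolynomialFunctions.

Definition St_alpha (R : finComNzRingType) : {set {perm dualnum R}} :=
  [set s in polyperms (dualnum R) | [forall a : R, s (dual_inj a) == dual_inj a]].

Arguments polyfuns A : clear implicits.
Arguments polyperms A : clear implicits.

Section DualNumbersTheory.
Variable R : finComNzRingType.

Lemma dual_alpha_sq : dual_alpha R ^+ 2 = 0.
Proof.
rewrite /dual_alpha /qpolyX -rmorphXn /=; apply/val_inj => /=.
by rewrite mk_monic_X2 Pdiv.RingMonic.rmodpp ?monicXn.
Qed.

Lemma dual_decomp (z : dualnum R) :
  exists! ab : R * R, z = dual_inj ab.1 + dual_inj ab.2 * dual_alpha R.
Proof.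
have sX : (size (mk_monic ('X^2 : {poly R}))).-1 = 2%N.
  by rewrite mk_monic_X2 size_polyXn.
have E (a b : R) : (dual_inj a + dual_inj b * dual_alpha R)
    = a%:P + b%:P * 'X :> {poly R}.
  rewrite /= mk_monic_X2.
  rewrite [Pdiv.CommonRing.rmodp 'X _]Pdiv.CommonRing.rmodp_small; last first.
    by rewrite size_polyX size_polyXn.
  rewrite Pdiv.CommonRing.rmodp_small // mul_polyC size_polyXn.
  by rewrite (leq_ltn_trans (size_scale_leq _ _)) // size_polyX.
have sz : (size (z : {poly R}) <= 2)%N by apply: leq_trans (size_npoly z) _; rewrite sX.
exists ((z : {poly R})`_0, (z : {poly R})`_1); split => [|[a b]] /=.
  apply/val_inj; apply: etrans (esym (E _ _)).
  apply/polyP => i; rewrite coefD coefC coefCM coefX.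
  case: i => [|[|i]] /=; rewrite ?mulr0 ?mulr1 ?addr0 ?add0r //.
  by rewrite nth_default // (leq_trans sz).
by move=> ->; rewrite E !coefD !coefC !coefCM !coefX /= !mulr0 !mulr1 addr0 add0r.
Qed.

End DualNumbersTheory.

(* Main.v *)
(* Writing a polynomial over R[alpha] as f + g alpha with f, g over R, one has
   (f + g alpha)(a + b alpha) = f(a) + (b f'(a) + g(a)) alpha, so the induced
   function amounts to the pair of functions ([f], [f']) together with [g]. The
   fibre of ([f], [f']) |-> [f] is a coset of D = {[h'] | h null on R}, whence
   |F(R[alpha])| = |F(R)|^2 |D|. An element of St_alpha(R) is
   a + b alpha |-> a + b (1 + h'(a)) alpha with h null, and such a map is
   bijective as soon as every 1 + h'(a) is regular. Over Z_(p^n) with n > 1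
   this always holds: expanding h(a + p) = 0 = h(a) to second order gives
   p h'(a) in (p^2), hence h'(a) in (p). *)
Require Import Defs.
From mathcomp Require Import all_boot all_fingroup all_order all_algebra.
From mathcomp Require Import boolp ring.

Set Implicit Arguments.
Unset Strict Implicit.
Unset Printing Implicit Defensive.

Import GRing.Theory.
Local Open Scope ring_scope.

Section DualNumbers.
Variable R : finComNzRingType.
Implicit Types (a b : R) (z : dualnum R) (f g h : {poly R}).

Definition mkdual a b : dualnum R := dual_inj a + dual_inj b * dual_alpha R.

Definition dual_parts z : R * R := projT1 (cid (dual_decomp z)).
Definition dre z := (dual_parts z).1.
Definition dim z := (dual_parts z).2.

Lemma mkdualK z : mkdual (dre z) (dim z) = z.
Proof. by rewrite /dre /dim /dual_parts; case: cid => ab [/= /esym]. Qed.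

Lemma dual_partsE a b : dual_parts (mkdual a b) = (a, b).
Proof. by rewrite /dual_parts; case: cid => ab [/= _ /(_ (a, b)) ->]. Qed.

Lemma dreE a b : dre (mkdual a b) = a. Proof. by rewrite /dre dual_partsE. Qed.
Lemma dimE a b : dim (mkdual a b) = b. Proof. by rewrite /dim dual_partsE. Qed.

Lemma mkdual0 a : mkdual a 0 = dual_inj a.
Proof. by rewrite /mkdual rmorph0 mul0r addr0. Qed.

Lemma mkdualD a b a' b' :
  mkdual a b + mkdual a' b' = mkdual (a + a') (b + b').
Proof. by rewrite /mkdual !rmorphD mulrDl addrACA. Qed.

Lemma mkdualM a b a' b' :
  mkdual a b * mkdual a' b' = mkdual (a * a') (a * b' + b * a').
Proof.
rewrite /mkdual !(rmorphD, rmorphM) /= !(mulrDl, mulrDr).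
rewrite [X in _ + X](_ : _ = dual_inj b * dual_alpha R * dual_inj a'); last first.
  by rewrite mulrACA -expr2 dual_alpha_sq mulr0 addr0.
by rewrite mulrAC !mulrA -addrA.
Qed.

(** Induction along Horner's scheme: multiplying by [mkdual a b] changes the alpha part exactly as
    the product rule prescribes for the derivative of [f * 'X + c]. *)
Lemma horner_map_dual f a b :
  (map_poly (@dual_inj R) f).[mkdual a b] = mkdual f.[a] (b * f^`().[a]).
Proof.
elim/poly_ind: f => [|f c IH].
  by rewrite rmorph0 deriv0 !horner0 mulr0 mkdual0 rmorph0.
rewrite rmorphD rmorphM /= map_polyX map_polyC [LHS]hornerMXaddC IH mkdualM.
rewrite -[X in _ + X]mkdual0 mkdualD derivMXaddC !hornerE mulrDr; congr mkdual.
by rewrite [f.[a] * b]mulrC mulrA.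
Qed.

Definition dual_poly f g : {poly dualnum R} :=
  map_poly (@dual_inj R) f + dual_alpha R *: map_poly (@dual_inj R) g.

Lemma horner_dual_poly f g a b :
  (dual_poly f g).[mkdual a b] = mkdual f.[a] (b * f^`().[a] + g.[a]).
Proof.
rewrite hornerD hornerZ !horner_map_dual.
have -> : dual_alpha R = mkdual 0 1 by rewrite /mkdual rmorph0 rmorph1 add0r mul1r.
by rewrite mkdualM mkdualD !mul0r mul1r add0r addr0.
Qed.

Lemma dual_polyP (F : {poly dualnum R}) : exists f g, F = dual_poly f g.
Proof.
exists (\poly_(i < size F) dre F`_i), (\poly_(i < size F) dim F`_i).
apply/polyP=> i; rewrite coefD coefZ !coef_map /= !coef_poly.
case: ltnP => [_|leFi]; first by rewrite [_ * dual_inj _]mulrC [RHS]mkdualK.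
by rewrite nth_default // rmorph0 mulr0 addr0.
Qed.

Definition null_poly h := forall a, h.[a] = 0.

Definition null_derivs : {set {ffun R -> R}} :=
  [set H : {ffun R -> R} |
    `[< exists2 h, null_poly h & forall a, H a = h^`().[a] >]].

(** The derivative of a representative depends on its choice, so one is fixed for each [F] as base
    point of the coset; [0] is a junk value off [polyfuns R]. *)
Definition poly_rep (F : {ffun R -> R}) : {poly R} :=
  if pselect (is_polyfun F) is left ex then projT1 (cid ex) else 0.

Lemma poly_repP F a : F \in polyfuns R -> (poly_rep F).[a] = F a.
Proof.
rewrite inE /poly_rep => /asboolP FP; case: pselect => // ex.
by case: cid => f /= ->.
Qed.

Definition dual_fun (u : {ffun R -> R} * {ffun R -> R} * {ffun R -> R}) :
    {ffun dualnum R -> dualnum R} :=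
  [ffun z => mkdual (u.1.1 (dre z))
     (dim z * ((poly_rep u.1.1)^`().[dre z] + u.2 (dre z)) + u.1.2 (dre z))].

(** The points with [b = 0] recover [F] and [G]; once these agree, the points with [b = 1] recover
    [H]. *)
Lemma dual_fun_inj : injective dual_fun.
Proof.
move=> [[F G] H] [[F' G'] H'] /ffunP eqF.
have {}eqF a b : dual_parts (dual_fun (F, G, H) (mkdual a b))
               = dual_parts (dual_fun (F', G', H') (mkdual a b)) by rewrite eqF.
have eF : F = F'.
  by apply/ffunP=> a; have := eqF a 0; rewrite !ffunE !dual_partsE !dreE => -[].
subst F'.
have eG : G = G'.
  apply/ffunP=> a; have := eqF a 0.
  by rewrite !ffunE !dual_partsE !dreE !dimE /= !mul0r !add0r => -[].
subst G'; congr (_, _, _); apply/ffunP=> a; have := eqF a 1.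
rewrite !ffunE !dual_partsE !dreE !dimE /= !mul1r => -[].
by move=> /addIr /addrI.
Qed.

Lemma polyfuns_dualE :
  polyfuns (dualnum R) =
    dual_fun @: setX (setX (polyfuns R) (polyfuns R)) null_derivs.
Proof.
apply/setP=> Phi; apply/idP/imsetP.
  rewrite inE => /asboolP[P PhiP]; have [f [g eP]] := dual_polyP P.
  pose F := [ffun a => f.[a]].
  have FP : F \in polyfuns R.
    by rewrite inE; apply/asboolP; exists f => a; rewrite ffunE.
  exists (F, [ffun a => g.[a]], [ffun a => (f - poly_rep F)^`().[a]]).
    rewrite !in_setX FP !inE /=; apply/andP; split; apply/asboolP.
      by exists g => a; rewrite ffunE.
    exists (f - poly_rep F) => a; last by rewrite ffunE.
    by rewrite hornerD hornerN poly_repP // ffunE subrr.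
  apply/ffunP=> z; rewrite PhiP eP !ffunE /= -{1}(mkdualK z) horner_dual_poly.
  by rewrite derivB hornerD hornerN [_ + (_ - _)]addrC subrK.
case=> [[[F G] H]]; rewrite !in_setX /= => /andP[/andP[FP GP] HP] ->.
rewrite inE; apply/asboolP.
move: HP; rewrite inE => /asboolP[h h0 Hh].
exists (dual_poly (poly_rep F + h) (poly_rep G)) => z.
rewrite -{2}(mkdualK z) horner_dual_poly ffunE /=.
by rewrite derivD !hornerD h0 addr0 !poly_repP // Hh.
Qed.

Lemma card_polyfuns_dual :
  #|polyfuns (dualnum R)| = (#|polyfuns R| ^ 2 * #|null_derivs|)%N.
Proof.
by rewrite polyfuns_dualE card_imset ?cardsX //; apply: dual_fun_inj.
Qed.

Definition stab_deriv (s : {perm dualnum R}) : {ffun R -> R} :=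
  [ffun a => dim (s (mkdual a 1)) - 1].

(** At [b = 0] the fixed points force [f.[a] = a] and [g.[a] = 0], so [h = f - 'X] is null. *)
Lemma St_alphaP (s : {perm dualnum R}) : s \in St_alpha R ->
  exists2 h, null_poly h &
    forall a b, s (mkdual a b) = mkdual a (b * (1 + h^`().[a])).
Proof.
rewrite !inE => /andP[/asboolP[P sP] /forallP sfix].
have [f [g eP]] := dual_polyP P.
have fg a : (f.[a] = a) * (g.[a] = 0).
  have /eqP := sfix a; rewrite -mkdual0 sP eP horner_dual_poly mul0r add0r.
  by move/(congr1 dual_parts); rewrite !dual_partsE => -[].
exists (f - 'X) => [a|a b].
  by rewrite hornerD hornerN hornerX fg subrr.
rewrite sP eP horner_dual_poly !fg addr0 derivB derivX hornerD hornerN hornerC.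
by rewrite addrC subrK.
Qed.

Lemma card_St_alpha :
    (forall h a, null_poly h -> GRing.lreg (1 + h^`().[a])) ->
  #|St_alpha R| = #|null_derivs|.
Proof.
move=> reg; rewrite -(@card_in_imset _ _ stab_deriv (mem (St_alpha R))); last first.
  move=> s t /St_alphaP[h _ sE] /St_alphaP[k _ tE] /ffunP est.
  apply/permP=> z; rewrite -(mkdualK z) sE tE.
  have := est (dre z); rewrite !ffunE sE tE !dimE !mul1r.
  by move=> /addIr ->.
apply: eq_card=> H; apply/imsetP/idP.
  case=> s /St_alphaP[h h0 sE] ->; rewrite inE; apply/asboolP; exists h => // a.
  by rewrite ffunE sE dimE mul1r addrC addKr.
rewrite inE => /asboolP[h h0 Hh].
(* A preimage of [H]: regularity of [1 + h'(a)] makes [sf] injective, hence a permutation of a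
   finite set. *)
pose sf z := (dual_poly ('X + h) 0).[z].
have sfE a b : sf (mkdual a b) = mkdual a (b * (1 + h^`().[a])).
  rewrite /sf horner_dual_poly derivD derivX !hornerD hornerX hornerC h0.
  by rewrite horner0 !addr0.
have sf_inj : injective sf.
  move=> z w; rewrite -(mkdualK z) -(mkdualK w) !sfE.
  move/(congr1 dual_parts); rewrite !dual_partsE => -[->].
  by rewrite ![_ * (1 + _)]mulrC => /(reg h _ h0) ->.
exists (perm sf_inj).
  rewrite !inE; apply/andP; split.
    by apply/asboolP; exists (dual_poly ('X + h) 0) => z; rewrite permE.
  by apply/forallP=> a; rewrite permE -mkdual0 sfE mul0r.
by apply/ffunP=> a; rewrite ffunE permE sfE dimE mul1r addrC addKr Hh.
Qed.

End DualNumbers.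

(** Leaving the remainder coefficient [c] unspecified avoids dividing by 2, so the expansion holds
    in every characteristic. *)
Lemma horner_taylor2 (R : comNzRingType) (f : {poly R}) (a t : R) :
  exists c, f.[a + t] = f.[a] + f^`().[a] * t + c * t ^+ 2.
Proof.
elim/poly_ind: f => [|f c [d IH]].
  by exists 0; rewrite deriv0 !horner0 !mul0r !addr0.
exists (f^`().[a] + d * (a + t)); rewrite derivMXaddC !hornerMXaddC hornerD hornerMX IH.
by ring.
Qed.

Lemma unit_1_deriv_null (p n : nat) (h : {poly 'Z_(p ^ n)}) (a : 'Z_(p ^ n)) :
  prime p -> (1 < n)%N -> null_poly h -> 1 + h^`().[a] \is a GRing.unit.
Proof.
move=> p_pr n_gt1 h0; set x := 1 + _.
have p_gt1 := prime_gt1 p_pr.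
have pn_gt1 : (1 < p ^ n)%N by rewrite -(exp1n n) ltn_exp2r // ltnW.
rewrite -(natr_Zp x) unitZpE // coprime_pexpl ?(ltnW n_gt1) // prime_coprime //.
apply/negP=> /dvdnP[q xq].
have pn0 : (p ^ n)%:R = 0 :> 'Z_(p ^ n) by rewrite pchar_Zp.
(* With [n = m + 2], the factor [p ^ m] kills every multiple of [p ^ 2]. *)
have def_n : n = (n - 2).+2 by rewrite -addn2 subnK.
move: (n - 2)%N def_n => m def_n.
have kill (y : 'Z_(p ^ n)) : (p ^ m)%:R * (y * p%:R ^+ 2) = 0.
  by rewrite mulrCA -natrX -natrM -expnD addn2 -def_n pn0 mulr0.
have [c] := horner_taylor2 h a p%:R; rewrite !h0 add0r => /esym hp.
(* If [p] divides [x], then [x * p] lies in the ideal of [p ^ 2]. The expansion [hp] puts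
   [h'(a) * p] there too, so [p ^ m.+1] would vanish modulo [p ^ m.+2]. *)
have : (p ^ m)%:R * (x * p%:R) = 0.
  by rewrite -(natr_Zp x) xq natrM -mulrA -expr2 kill.
rewrite mulrDl mul1r mulrDr.
have -> : (p ^ m)%:R * (h^`().[a] * p%:R) = 0.
  by rewrite -[LHS]addr0 -(kill c) -mulrDr hp mulr0.
rewrite addr0 -natrM -expnSr => /(congr1 val) /=.
rewrite val_Zp_nat // modn_small ?def_n ?ltn_exp2l // => /eqP.
by rewrite expn_eq0 => /andP[/eqP p0]; rewrite p0 in p_gt1.
Qed.

Theorem corollary7p8 (p n : nat) (p_prime : prime p) (n_gt1 : (1 < n)%N) :
  (#|polyfuns (dualnum 'Z_(p ^ n))|
    = #|polyfuns 'Z_(p ^ n)| ^ 2 * #|St_alpha 'Z_(p ^ n)|)%N.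
Proof.
rewrite card_polyfuns_dual card_St_alpha // => h a h0.
by apply: mulrI; apply: unit_1_deriv_null.
Qed.
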